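(* Let $q\ge1$ and let $i_1,\dots,i_q$ be integers with $1\le i_1<\cdots<i_q\le 6$. Then there exists an $8$-dimensional integral polytope $\mathcal{P}$ such that the coefficients of $t^{i_1},\dots,t^{i_q}$ in $i(\mathcal{P},t)$ are negative, and all the remaining coefficients of $i(\mathcal{P},t)$ are positive.
   Context: An integral polytope is a convex polytope all of whose vertices have integer coordinates. For an integral polytope $\mathcal{P}\subseteq\mathbb{R}^N$ of dimension $d$, $i(\mathcal{P},t)=|t\mathcal{P}\cap\mathbb{Z}^N|$ ($t$ a positive integer) is a polynomial in $t$ of degree $d$, the Ehrhart polynomial. *)

(* Defs.v *)
From HB Require Import structures.
From mathcomp Require Import all_boot all_order all_algebra.
From mathcomp Require Import boolp classical_sets functions cardinality reals.

Set Implicit Arguments.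
Unset Strict Implicit.
Unset Printing Implicit Defensive.

Import Order.TTheory GRing.Theory Num.Theory.
Local Open Scope classical_set_scope.
Local Open Scope card_scope.
Local Open Scope ring_scope.

Section Polytopes.
Variables (R : realType) (N : nat).
Implicit Types (A P : set 'rV[R]_N) (x : 'rV[R]_N) (p : {poly R}).

Definition affine_hull A : set 'rV[R]_N :=
  [set x | exists (n : nat) (v : 'I_n -> 'rV[R]_N) (w : 'I_n -> R),
    [/\ forall k, A (v k), \sum_k w k = 1 & x = \sum_k w k *: v k]].

Definition convex_hull A : set 'rV[R]_N :=
  [set x | exists (n : nat) (v : 'I_n -> 'rV[R]_N) (w : 'I_n -> R),
    [/\ forall k, A (v k), forall k, 0 <= w k,
        \sum_k w k = 1 & x = \sum_k w k *: v k]].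

Definition convex_polytope P : Prop :=
  exists2 A : set 'rV[R]_N, finite_set A & P = convex_hull A.

(* The vertices of a polytope are its extreme points. *)
Definition vertex P x : Prop :=
  P x /\ forall (y z : 'rV[R]_N) (t : R), P y -> P z -> 0 < t < 1 ->
    x = t *: y + (1 - t) *: z -> y = x /\ z = x.

Definition integer_points : set 'rV[R]_N :=
  [set x | forall k, x 0 k \is a Num.int].

Definition integral_polytope P : Prop :=
  convex_polytope P /\ vertex P `<=` integer_points.

(* The affine hull of P is a translate of a d-dimensional linear subspace;
   in particular P is nonempty. *)
Definition has_dim P (d : nat) : Prop :=
  exists (x : 'rV[R]_N) (U : {vspace 'rV[R]_N}),
    \dim U = d /\ affine_hull P = [set x + u | u in [set u | u \in U]].

Definition dilate (t : nat) P : set 'rV[R]_N := [set t%:R *: x | x in P].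

(* p.[t] = |tP `&` Z^N| for all t >= 1. Stated with #= rather than with a total
   cardinal function, so that finiteness of tP `&` Z^N is part of the claim. *)
Definition ehrhart_polynomial P p : Prop :=
  forall t : nat, (0 < t)%N ->
    exists2 m : nat, dilate t P `&` integer_points #= `I_m & p.[t%:R] = m%:R.

Lemma ehrhart_polynomial_unique P p q :
  ehrhart_polynomial P p -> ehrhart_polynomial P q -> p = q.
Proof.
move=> Pp Pq; apply/eqP; rewrite -subr_eq0; apply/negPn/negP => pq0.
pose s : seq R := [seq k.+1%:R | k <- iota 0 (size (p - q))].
have us : uniq s.
  rewrite map_inj_uniq ?iota_uniq// => a b /eqP.
  by rewrite eqr_nat => /eqP[].
have := max_poly_roots pq0 _ us; rewrite size_map size_iota ltnn => H.
apply: notF; apply: H; apply/allP => _ /mapP[k _ ->].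
have [m Pm pm] := Pp k.+1 isT; have [l Pl ql] := Pq k.+1 isT.
have ml : m = l.
  by apply/card_eq_II/(card_eq_trans _ Pl); rewrite card_eq_sym.
by rewrite rootE !hornerE pm ql ml subrr.
Qed.

End Polytopes.

(* Main.v *)
(* Ehrhart polynomials multiply under products and are rescaled by dilations, so
   it suffices to find, for each of the 63 patterns, a product of small polytopes
   whose Ehrhart polynomial has the right signs. Dilated copies of three families
   are enough: the unit segment, a lattice triangle with h* = 1 + k z + k z^2, and
   the Reeve tetrahedron with h* = 1 + n z^2. The last two are simplices P whose
   vertices generate a sublattice with cyclic quotient Z/m: a lattice point of tP
   is determined by its class r modulo m and by the integer parts of its
   barycentric coordinates, which gives i(P,t) = sum_r C(t + d - age r, d). *)
From Stdlib Require Import ZArith.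
Require Import Defs.
From HB Require Import structures.
From mathcomp Require Import all_boot all_order all_algebra.
From mathcomp Require Import boolp classical_sets functions cardinality reals.
From mathcomp Require Import ring zify ssrZ.

Set Implicit Arguments.
Unset Strict Implicit.
Unset Printing Implicit Defensive.

Import Order.TTheory GRing.Theory Num.Theory.
Local Open Scope classical_set_scope.
Local Open Scope ring_scope.

(** * Lattice hulls, products and dilations *)

Section Hulls.
Variable R : realType.

Lemma convex_hull_sum N (A : set 'rV[R]_N) (I : finType)
    (v : I -> 'rV[R]_N) (w : I -> R) :
  (forall i, A (v i)) -> (forall i, 0 <= w i) -> \sum_i w i = 1 ->
  convex_hull A (\sum_i w i *: v i).
Proof.
move=> Av w0 w1; exists #|I|, (v \o enum_val), (w \o enum_val).
split=> [k|k||]; [exact: Av|exact: w0| |].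
- by rewrite -w1 (reindex _ (onW_bij _ (@enum_val_bij I))).
- by rewrite (reindex _ (onW_bij _ (@enum_val_bij I))).
Qed.

Lemma affine_hull_sum N (A : set 'rV[R]_N) (I : finType)
    (v : I -> 'rV[R]_N) (w : I -> R) :
  (forall i, A (v i)) -> \sum_i w i = 1 -> affine_hull A (\sum_i w i *: v i).
Proof.
move=> Av w1; exists #|I|, (v \o enum_val), (w \o enum_val).
split=> [k||]; [exact: Av| |].
- by rewrite -w1 (reindex _ (onW_bij _ (@enum_val_bij I))).
- by rewrite (reindex _ (onW_bij _ (@enum_val_bij I))).
Qed.

Lemma sub_convex_hull N (A : set 'rV[R]_N) : A `<=` convex_hull A.
Proof.
move=> x Ax; exists 1%N, (fun=> x), (fun=> 1).
by split=> //; rewrite ?big_ord1 ?scale1r.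
Qed.

(* A point v_k of positive weight in a convex combination x splits off as
   x = w_k v_k + (1 - w_k) y, so an extreme x equals v_k. *)
Lemma vertex_convex_hull N (A : set 'rV[R]_N) : vertex (convex_hull A) `<=` A.
Proof.
move=> x [[n [v [w [Av w0 w1 xE]]]] ext].
have [k wk] : exists k, 0 < w k.
  apply: contrapT => /forallNP wN.
  move: w1; rewrite big1 => [/esym/eqP|k _]; first by rewrite oner_eq0.
  by apply/eqP; rewrite eq_le w0 leNgt; apply/andP; split=> //; apply/negP/wN.
have [wk1|wk1] := eqVneq (w k) 1.
  suff -> : x = v k by [].
  have wN j : j != k -> w j = 0.
    move: w1; rewrite (bigD1 k)//= wk1 => /eqP.
    rewrite -subr_eq0 addrAC subrr add0r psumr_eq0// => /allP/(_ j).
    by rewrite mem_index_enum => /(_ isT)/implyP h /h/eqP.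
  by rewrite xE (bigD1 k)//= wk1 scale1r big1 ?addr0// => j /wN->; rewrite scale0r.
have sE : \sum_(j | j != k) w j = 1 - w k.
  by rewrite -w1 [in RHS](bigD1 k)//= addrAC subrr add0r.
have wk_lt1 : w k < 1.
  by rewrite lt_neqAle wk1 -subr_ge0 -sE sumr_ge0.
have wN0 : 1 - w k != 0 by rewrite subr_eq0 eq_sym.
pose u j := if j == k then 0 else w j / (1 - w k).
have uP : convex_hull A (\sum_j u j *: v j).
  apply: convex_hull_sum => [//|j|].
    by rewrite /u; case: eqP => // _; rewrite divr_ge0// subr_ge0 ltW.
  rewrite (bigD1 k)//= /u eqxx add0r -[RHS](mulfV wN0) -{2}sE mulr_suml.
  by apply: eq_bigr => j /negPf->.
have [||<- _//] := ext _ _ (w k) (sub_convex_hull (Av k)) uP; first by apply/andP.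
rewrite xE (bigD1 k)//=; congr (_ + _).
rewrite scaler_sumr [RHS](bigD1 k)//= /u eqxx scale0r scaler0 add0r.
by apply: eq_bigr => j /negPf->; rewrite scalerA mulrC divfK.
Qed.

(** A finite integral generating set is carried along instead of the vertex set. It passes directly
    to products and dilations, and it suffices for integrality because extreme points of a hull lie
    in the generating set. *)
Definition lattice_hull N (P : set 'rV[R]_N) : Prop :=
  exists A : set 'rV[R]_N,
    [/\ finite_set A, A `<=` @integer_points R N & P = convex_hull A].

Lemma lattice_hull_integral N (P : set 'rV[R]_N) :
  lattice_hull P -> integral_polytope P.
Proof.
move=> [A [finA intA ->]]; split; first by exists A.
by move=> x /vertex_convex_hull/intA.
Qed.

Lemma has_dim_full N (P : set 'rV[R]_N) : affine_hull P = setT -> has_dim P N.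
Proof.
move=> hP; exists 0, fullv; split; first by rewrite dimvf /dim/= mul1n.
by rewrite hP; apply/esym/seteqP; split=> // x _; exists x; rewrite ?add0r//= memvf.
Qed.

(** * Products of polytopes *)

Definition prodv m n (A : set 'rV[R]_m) (B : set 'rV[R]_n) : set 'rV[R]_(m + n) :=
  [set u | A (lsubmx u) /\ B (rsubmx u)].

Lemma prodvE m n (A : set 'rV[R]_m) (B : set 'rV[R]_n) :
  prodv A B = (fun z => row_mx z.1 z.2) @` (A `*` B).
Proof.
apply/seteqP; split=> [u [Au Bu]|_ [[x y] [/= Ax By] <-]].
  by exists (lsubmx u, rsubmx u) => //=; rewrite hsubmxK.
by split; rewrite ?row_mxKl ?row_mxKr.
Qed.

Lemma row_mx_sum (I : finType) m n (w : I -> R) (x : I -> 'rV[R]_m) (y : I -> 'rV[R]_n) :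
  \sum_i w i *: row_mx (x i) (y i) = row_mx (\sum_i w i *: x i) (\sum_i w i *: y i).
Proof.
apply/rowP => j; rewrite !mxE summxE; case: splitP => k jk; rewrite summxE;
  apply: eq_bigr => i _; rewrite !mxE; case: splitP => l jl; congr (_ * _).
- by congr (x i _ _); apply/val_inj; rewrite /= -jk.
- by have := ltn_ord k; rewrite -jk jl ltnNge leq_addr.
- by have := ltn_ord l; rewrite -jl jk ltnNge leq_addr.
- by congr (y i _ _); apply/val_inj/(@addnI m); rewrite /= -jk.
Qed.

(** The product weights [a i * b j] have marginals [a] and [b], as each family sums to 1. A pair of
    combinations thus becomes one combination of pairs. *)
Lemma row_mx_sum2 (I J : finType) m n (a : I -> R) (b : J -> R)
    (x : I -> 'rV[R]_m) (y : J -> 'rV[R]_n) :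
  \sum_i a i = 1 -> \sum_j b j = 1 ->
  row_mx (\sum_i a i *: x i) (\sum_j b j *: y j) =
  \sum_(z : I * J) (a z.1 * b z.2) *: row_mx (x z.1) (y z.2).
Proof.
move=> a1 b1; rewrite row_mx_sum; congr row_mx.
- rewrite -(pair_bigA _ (fun i j => (a i * b j) *: x i))/=.
  by apply: eq_bigr => i _; rewrite -scaler_suml -mulr_sumr b1 mulr1.
- rewrite -(pair_bigA _ (fun i j => (a i * b j) *: y j))/= exchange_big/=.
  by apply: eq_bigr => j _; rewrite -scaler_suml -mulr_suml a1 mul1r.
Qed.

Lemma sum_mul_pair (I J : finType) (a : I -> R) (b : J -> R) :
  \sum_i a i = 1 -> \sum_j b j = 1 -> \sum_(z : I * J) (a z.1 * b z.2) = 1.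
Proof.
move=> a1 b1; rewrite -(pair_bigA _ (fun i j => a i * b j))/= -{}[RHS]a1.
by apply: eq_bigr => i _; rewrite -mulr_sumr b1 mulr1.
Qed.

Lemma convex_hull_prodv m n (A : set 'rV[R]_m) (B : set 'rV[R]_n) :
  convex_hull (prodv A B) = prodv (convex_hull A) (convex_hull B).
Proof.
apply/seteqP; split=> [u [k [v [w [vAB w0 w1 ->]]]]|u].
  rewrite (eq_bigr (fun i => w i *: row_mx (lsubmx (v i)) (rsubmx (v i)))); last first.
    by move=> i _; rewrite hsubmxK.
  rewrite row_mx_sum; split; rewrite ?row_mxKl ?row_mxKr;
    by apply: convex_hull_sum => // i; case: (vAB i).
rewrite -[u]hsubmxK => -[].
rewrite row_mxKl row_mxKr => -[k [v [a [Av a0 a1 ->]]]] [l [w [b [Bw b0 b1 ->]]]].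
rewrite row_mx_sum2//; apply: convex_hull_sum => [[i j]|[i j]|] /=.
- by split; rewrite ?row_mxKl ?row_mxKr.
- by rewrite mulr_ge0.
- exact: sum_mul_pair.
Qed.

Lemma affine_hull_prodv m n (A : set 'rV[R]_m) (B : set 'rV[R]_n) :
  affine_hull A = setT -> affine_hull B = setT -> affine_hull (prodv A B) = setT.
Proof.
move=> hA hB; apply/seteqP; split=> // u _; rewrite -[u]hsubmxK.
have : affine_hull A (lsubmx u) by rewrite hA.
have : affine_hull B (rsubmx u) by rewrite hB.
move=> [l [w [b [Bw b1 ->]]]] [k [v [a [Av a1 ->]]]].
rewrite row_mx_sum2//; apply: affine_hull_sum => [[i j]|] /=.
- by split; rewrite ?row_mxKl ?row_mxKr.
- exact: sum_mul_pair.
Qed.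

Lemma integer_points_prodv m n :
  @integer_points R (m + n) = prodv (@integer_points R m) (@integer_points R n).
Proof.
apply/seteqP; split=> [u uZ|u [lZ rZ] k]; first by split=> k; rewrite mxE; apply: uZ.
rewrite -[u]hsubmxK mxE; case: splitP => j _; [exact: lZ|exact: rZ].
Qed.

Lemma dilate_prodv m n t (P : set 'rV[R]_m) (Q : set 'rV[R]_n) :
  dilate t (prodv P Q) = prodv (dilate t P) (dilate t Q).
Proof.
apply/seteqP; split=> [_ [u [Pu Qu] <-]|u [[x Px xu] [y Qy yu]]].
  by split; [exists (lsubmx u)|exists (rsubmx u)] => //; rewrite linearZ.
exists (row_mx x y); first by split; rewrite ?row_mxKl ?row_mxKr.
by rewrite scale_row_mx xu yu hsubmxK.
Qed.

Lemma card_eq_ord (T : choiceType) (A : set T) (I : finType) (f : I -> T) :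
  injective f -> range f = A -> (A #= `I_#|I|)%card.
Proof.
move=> f_inj <-; rewrite (card_eql (inj_card_eq _)); last by move=> x y _ _ /f_inj.
rewrite card_eq_sym (card_eql card_II) card_eq_sym.
suff <- : range (@enum_rank I) = setT.
  by rewrite card_eq_sym inj_card_eq// => x y _ _ /enum_rank_inj.
by apply/seteqP; split=> // x _; exists (enum_val x); rewrite ?enum_valK.
Qed.

Lemma card_eq_ordP (T : choiceType) (A : set T) k :
  (A #= `I_k)%card -> exists2 f : 'I_k -> T, injective f & range f = A.
Proof.
move=> /card_esym; rewrite (card_eql card_II) => /card_bijP[f [g fK gK]].
exists (fun i => val (f (SigSub (mem_set (I : setT i))))).
  move=> i j /val_inj/(can_inj fK)/(congr1 val); exact.
apply/seteqP; split=> [_ [i _ <-]|x Ax]; first exact/set_mem/valP.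
exists (val (g (SigSub (mem_set Ax)))) => //.
set y := SigSub _; suff -> : y = g (SigSub (mem_set Ax)) by rewrite gK.
exact/val_inj.
Qed.

Lemma card_eq_prodv m n (A : set 'rV[R]_m) (B : set 'rV[R]_n) k l :
  (A #= `I_k -> B #= `I_l -> prodv A B #= `I_(k * l))%card.
Proof.
move=> /card_eq_ordP[f f_inj fA] /card_eq_ordP[g g_inj gB].
have -> : (k * l = #|{: 'I_k * 'I_l}|)%N by rewrite card_prod !card_ord.
apply: (@card_eq_ord _ _ _ (fun z => row_mx (f z.1) (g z.2))).
  by move=> [i j] [i' j'] /= /eq_row_mx[/f_inj-> /g_inj->].
apply/seteqP; split=> [_ [[i j] _ <-]|u []].
  by rewrite -fA -gB; split=> /=; [rewrite row_mxKl; exists i|rewrite row_mxKr; exists j].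
rewrite -fA -gB => -[i _ iu] [j _ ju]; exists (i, j) => //=.
by rewrite iu ju hsubmxK.
Qed.

(** The polytope is required to span its ambient space, so that [d] is both the ambient dimension
    and the dimension of the polytope, and adds up under products. *)
Definition realizes d (p : {poly R}) : Prop :=
  exists P : set 'rV[R]_d,
    [/\ lattice_hull P, affine_hull P = setT & ehrhart_polynomial P p].

Lemma realizes_mul m n p q : realizes m p -> realizes n q -> realizes (m + n) (p * q).
Proof.
move=> [P [[A [finA intA PA]] hP pP]] [Q [[B [finB intB QB]] hQ qQ]].
exists (prodv P Q); split; last 2 first.
- exact: affine_hull_prodv.
- move=> t t0; have [k Pk pk] := pP _ t0; have [l Ql ql] := qQ _ t0.
  exists (k * l)%N; last by rewrite hornerM pk ql natrM.
  suff -> : dilate t (prodv P Q) `&` @integer_points R (m + n) =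
     prodv (dilate t P `&` @integer_points R m) (dilate t Q `&` @integer_points R n).
    exact: card_eq_prodv.
  rewrite dilate_prodv integer_points_prodv.
  by apply/seteqP; split=> u; [move=> [[? ?] [? ?]]|move=> [[? ?] [? ?]]].
exists (prodv A B); split.
- by rewrite prodvE; apply/finite_image/finite_setX.
- by rewrite integer_points_prodv => u [/intA ? /intB ?].
- by rewrite convex_hull_prodv PA QB.
Qed.

(** * Dilations *)

Lemma convex_hull_dilate N t (A : set 'rV[R]_N) :
  convex_hull (dilate t A) = dilate t (convex_hull A).
Proof.
apply/seteqP; split=> [u [k [v [w [vA w0 w1 ->]]]]|_ [_ [k [v [w [vA w0 w1 ->]]]] <-]].
  have [x xP] : {x : 'I_k -> 'rV[R]_N & forall i, A (x i) /\ t%:R *: x i = v i}.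
    apply: (@choice _ _ (fun i x => A x /\ t%:R *: x = v i)) => i.
    by have [x Ax xv] := vA i; exists x.
  exists (\sum_i w i *: x i).
    by apply: convex_hull_sum => // i; case: (xP i).
  rewrite scaler_sumr; apply: eq_bigr => i _.
  by rewrite scalerA mulrC -scalerA; case: (xP i) => _ ->.
rewrite scaler_sumr (eq_bigr (fun i => w i *: (t%:R *: v i))); last first.
  by move=> i _; rewrite !scalerA mulrC.
by apply: convex_hull_sum => // i; exists (v i).
Qed.

Lemma dilate_dilate N s t (A : set 'rV[R]_N) :
  dilate s (dilate t A) = dilate (s * t) A.
Proof.
apply/seteqP; split=> [_ [_ [x Ax <-] <-]|_ [x Ax <-]].
  by exists x; rewrite ?scalerA ?natrM.
by exists (t%:R *: x); [exists x|rewrite scalerA natrM].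
Qed.

(** Since t(cP) = (tc)P, dilating by [c] substitutes ct for t. *)
Lemma realizes_dilate d p c : (0 < c)%N -> realizes d p ->
  realizes d (p \Po (c%:R *: 'X)).
Proof.
move=> c0 [P [[A [finA intA PA]] hP pP]]; exists (dilate c P); split.
- exists (dilate c A); split; first exact: finite_image.
    by move=> _ [x /intA xZ <-] k; rewrite mxE rpredM ?natr_int.
  by rewrite PA convex_hull_dilate.
- apply/seteqP; split=> // u _.
  have c0R : c%:R != 0 :> R by rewrite pnatr_eq0 -lt0n.
  have : affine_hull P (c%:R^-1 *: u) by rewrite hP.
  move=> [k [v [w [Pv w1 uE]]]].
  have -> : u = \sum_i w i *: (c%:R *: v i).
    rewrite -[LHS](scalerKV c0R) uE scaler_sumr.
    by apply: eq_bigr => i _; rewrite !scalerA mulrC.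
  by apply: affine_hull_sum => // i; exists (v i).
- move=> t t0; have [|k Pk pk] := pP (t * c)%N; first by rewrite muln_gt0 t0.
  exists k; first by rewrite dilate_dilate.
  by rewrite horner_comp hornerZ hornerX -natrM mulnC.
Qed.

End Hulls.

(** * Simplices with cyclic lattice quotient *)

Section Simplices.
Variable R : realType.

(** * Simplices with a vertex at the origin *)

Definition simplex_vertices d (V : 'M[R]_d) : set 'rV[R]_d :=
  [set x | x = 0 \/ exists i, x = row i V].

Lemma simplex_vertices_option d (V : 'M[R]_d) (i : option 'I_d) :
  simplex_vertices V (if i is Some j then row j V else 0).
Proof. by case: i => [i|]; [right; exists i|left]. Qed.

Lemma finite_simplex_vertices d (V : 'M[R]_d) : finite_set (simplex_vertices V).
Proof.
have -> : simplex_vertices V =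
    range (fun i : option 'I_d => if i is Some j then row j V else 0).
  apply/seteqP; split=> [x [->|[i ->]]|_ [i _ <-]]; [by exists None|by exists (Some i)|].
  exact: simplex_vertices_option.
exact/finite_image/finite_finset.
Qed.

Lemma sum_option (U : nmodType) (I : finType) (F : option I -> U) :
  \sum_i F i = F None + \sum_i F (Some i).
Proof.
rewrite (bigD1 None)//=; congr (_ + _).
rewrite (reindex_omap Some id); last by case.
by apply: eq_bigl => i; rewrite /= eqxx.
Qed.

(** The index [None] stands for the vertex 0, whose weight is the slack 1 - sum of x. This term adds
    nothing to the point but makes the weights sum to 1. *)
Lemma simplex_sum d (V : 'M[R]_d) (x : 'rV[R]_d) :
  x *m V = \sum_(i : option 'I_d)
    (if i is Some j then x 0 j else 1 - \sum_j x 0 j) *: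
    (if i is Some j then row j V else 0).
Proof. by rewrite sum_option scaler0 add0r mulmx_sum_row. Qed.

Lemma convex_hull_simplex d (V : 'M[R]_d) :
  convex_hull (simplex_vertices V) =
  [set x *m V | x in [set x : 'rV[R]_d | (forall i, 0 <= x 0 i) /\ \sum_i x 0 i <= 1]].
Proof.
apply/seteqP; split=> [_ [k [v [w [vA w0 w1 ->]]]]|_ [x [x0 x1] <-]].
  have [x xP] : {x : 'I_k -> 'rV[R]_d &
      forall i, [/\ forall j, 0 <= x i 0 j, \sum_j x i 0 j <= 1 & x i *m V = v i]}.
    apply: (@choice _ _ (fun i (x : 'rV[R]_d) =>
      [/\ forall j, 0 <= x 0 j, \sum_j x 0 j <= 1 & x *m V = v i])) => i.
    have [->|[j ->]] := vA i.
      exists 0; rewrite mul0mx; split=> // [j|]; first by rewrite mxE.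
      by rewrite big1// => j _; rewrite mxE.
    exists (delta_mx 0 j); rewrite -rowE; split=> // [l|]; first by rewrite mxE ler0n.
    rewrite (bigD1 j)//= mxE !eqxx big1 ?addr0// => l lj.
    by rewrite mxE (negPf lj) andbF.
  exists (\sum_i w i *: x i); first split.
  - move=> j; rewrite summxE sumr_ge0// => i _.
    by rewrite mxE mulr_ge0//; case: (xP i).
  - under eq_bigr do rewrite summxE; rewrite exchange_big/= -w1 ler_sum// => i _.
    under eq_bigr do rewrite mxE; rewrite -mulr_sumr ler_piMr//; by case: (xP i).
  - rewrite mulmx_suml; apply: eq_bigr => i _.
    by rewrite -scalemxAl; case: (xP i) => _ _ ->.
rewrite simplex_sum; apply: convex_hull_sum => [i|[i|]|].
- exact: simplex_vertices_option.
- exact: x0.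
- by rewrite subr_ge0.
- by rewrite sum_option subrK.
Qed.

Lemma dilate_simplex d (V : 'M[R]_d) t : (0 < t)%N ->
  dilate t (convex_hull (simplex_vertices V)) =
  [set x *m V | x in [set x : 'rV[R]_d | (forall i, 0 <= x 0 i) /\ \sum_i x 0 i <= t%:R]].
Proof.
move=> t0; have tR : 0 < t%:R :> R by rewrite ltr0n.
rewrite convex_hull_simplex.
apply/seteqP; split=> [_ [_ [x [x0 x1] <-] <-]|_ [x [x0 x1] <-]].
  exists (t%:R *: x); last by rewrite scalemxAl.
  split=> [i|]; first by rewrite mxE mulr_ge0// ltW.
  by under eq_bigr do rewrite mxE; rewrite -mulr_sumr ger_pMr.
exists ((t%:R^-1 *: x) *m V); last by rewrite -scalemxAl scalerKV ?gt_eqF.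
exists (t%:R^-1 *: x) => //; split=> [i|].
  by rewrite mxE mulr_ge0// invr_ge0 ltW.
by under eq_bigr do rewrite mxE; rewrite -mulr_sumr ler_pdivrMl ?mulr1.
Qed.

Lemma affine_hull_simplex d (V : 'M[R]_d) : V \in unitmx ->
  affine_hull (convex_hull (simplex_vertices V)) = setT.
Proof.
move=> uV; apply/seteqP; split=> // x _; rewrite -[x](mulmxKV uV) simplex_sum.
apply: affine_hull_sum => [i|]; last by rewrite sum_option subrK.
exact/sub_convex_hull/simplex_vertices_option.
Qed.

(* With the vertex 0, the rows are the vertices of the simplex: e_1, ..., e_d and
   m e_0 - a_1 e_1 - ... - a_d e_d. *)
Definition cyclic_mx d (m : nat) (a : 'I_d.+1 -> nat) : 'M[R]_d.+1 :=
  \matrix_(i, j) if i == ord0 then if j == ord0 then m%:R else - (a j)%:R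
                 else (i == j)%:R.

Variables (d m : nat) (a : 'I_d.+1 -> nat).
Hypotheses (m_gt0 : (0 < m)%N) (a1 : a ord0 = 1%N).
Let V : 'M[R]_d.+1 := cyclic_mx m a.

Let mR : m%:R != 0 :> R.
Proof. by rewrite pnatr_eq0 -lt0n. Qed.

Lemma cyclic_mxM (x : 'rV[R]_d.+1) j :
  (x *m V) 0 j = if j == ord0 then x 0 ord0 * m%:R else x 0 j - x 0 ord0 * (a j)%:R.
Proof.
rewrite mxE (bigD1 ord0)//= mxE eqxx.
have sE : \sum_(i < d.+1 | i != ord0) x 0 i * V i j = if j == ord0 then 0 else x 0 j.
  have [->|j0] := eqVneq j ord0.
    by rewrite big1// => i i0; rewrite mxE (negPf i0) mulr0.
  rewrite (bigD1 j)//= mxE (negPf j0) eqxx mulr1 big1 ?addr0// => i /andP[i0 ij].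
  by rewrite mxE (negPf i0) (negPf ij) mulr0.
by rewrite sE; case: eqVneq => // _; rewrite ?addr0// mulrN addrC.
Qed.

(** The matrix is upper triangular with diagonal m, 1, ..., 1. It is transposed because [det_trig]
    concerns lower triangular matrices. *)
Lemma cyclic_mx_unit : V \in unitmx.
Proof.
rewrite -unitmx_tr unitmxE det_trig; last first.
  apply/is_trig_mxP => i j ij; rewrite !mxE.
  have /negPf -> : j != ord0 by rewrite -lt0n (leq_ltn_trans _ ij).
  by rewrite -val_eqE gtn_eqF.
rewrite unitfE (bigD1 ord0)//= !mxE eqxx mulf_neq0//.
by rewrite big1 ?oner_neq0// => i i0; rewrite !mxE (negPf i0) eqxx.
Qed.

Definition residue (r : nat) (j : 'I_d.+1) := ((a j * r) %% m)%N.
(* The fractional parts of the barycentric coordinates (other than that of the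
   vertex 0) in the class [r] are [residue r j / m]; [age r] is the ceiling of
   their sum. *)
Definition age (r : nat) := ((\sum_j residue r j + m.-1) %/ m)%N.

Lemma residue0 r : (r < m)%N -> residue r ord0 = r.
Proof. by move=> rm; rewrite /residue a1 mul1n modn_small. Qed.

(** These are coordinates with respect to the rows of [V]: integer parts [n], and fractional parts
    determined by the class [r]. *)
Definition cyclic_point (r : nat) (n : 'I_d.+1 -> nat) : 'rV[R]_d.+1 :=
  \row_j ((n j)%:R + (residue r j)%:R / m%:R).

Lemma cyclic_point_ge0 r n j : 0 <= cyclic_point r n 0 j.
Proof. by rewrite mxE addr_ge0// divr_ge0. Qed.

(** After multiplication by m, the claim is that a sum f of residues satisfies f <= m(t - s) exactly
    when its ceiling f/m is at most t - s. *)
Lemma cyclic_point_le r n t :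
  (\sum_j cyclic_point r n 0 j <= t%:R) = (\sum_j n j + age r <= t)%N.
Proof.
rewrite (eq_bigr (fun j => (n j)%:R + (residue r j)%:R / m%:R)) => [|j _]; last by rewrite mxE.
rewrite big_split/= -mulr_suml -!natr_sum.
rewrite -(ler_pM2r (_ : 0 < m%:R)) ?ltr0n// mulrDl divfK//.
rewrite -!natrM -natrD ler_nat /age.
set s := (\sum_j _)%N; set f := (\sum_j _)%N.
have := divn_eq (f + m.-1) m; have := ltn_pmod (f + m.-1) m_gt0.
move: (_ %/ _)%N (_ %% _)%N m_gt0 => A B ? ? ?; apply/idP/idP; nia.
Qed.

Lemma residue_div r j : (residue r j + (a j * r) %/ m * m = a j * r)%N.
Proof. by rewrite addnC -divn_eq. Qed.

(** In a column j other than 0, the fractional part of x_j agrees with a_j r / m modulo 1, and this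
    is cancelled by the term x_0 a_j up to an integer. *)
Lemma cyclic_point_int r n : (r < m)%N -> integer_points (cyclic_point r n *m V).
Proof.
move=> rm j; rewrite cyclic_mxM !mxE residue0//.
case: eqP => _; first by rewrite mulrDl divfK// rpredD ?rpredM ?natr_int.
have -> : (residue r j)%:R = (a j * r)%:R - ((a j * r) %/ m * m)%:R :> R.
  by apply/eqP; rewrite eq_sym subr_eq -natrD residue_div.
rewrite !natrM; set q := (_ %/ _)%:R.
have -> : (n j)%:R + ((a j)%:R * r%:R - q * m%:R) / m%:R -
   ((n ord0)%:R + r%:R / m%:R) * (a j)%:R = (n j)%:R - q - (n ord0)%:R * (a j)%:R.
  by field.
by rewrite !rpredB ?rpredM ?natr_int.
Qed.

(** As k/m < 1 and x >= 0, the integer x - k/m exceeds -1, so it is a natural number. *)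
Lemma int_natP (x : R) (k : nat) : (k < m)%N -> 0 <= x ->
  x - k%:R / m%:R \is a Num.int -> exists n : nat, x = n%:R + k%:R / m%:R.
Proof.
move=> km x0 xZ.
have y1 : 0 < x - k%:R / m%:R + 1.
  rewrite -addrA ltr_wpDl// addrC subr_gt0 ltr_pdivrMr ?ltr0n// mul1r ltr_nat//.
move: xZ y1 => /intrP[z zE]; rewrite zE -[1]/(1%:~R) -intrD ltr0z => z0.
case: z zE z0 => [n|n] zE z0; last by lia.
by exists n; rewrite -[n%:R]/(n%:~R) -zE subrK.
Qed.

(** Column 0 shows that m x_0 is a natural number Y, and the class is Y mod m. Every other column
    forces x_j to be congruent to a_j x_0 modulo 1, which fixes its fractional part. *)
Lemma cyclic_point_surj (x : 'rV[R]_d.+1) :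
  (forall j, 0 <= x 0 j) -> integer_points (x *m V) ->
  exists r n, (r < m)%N /\ x = cyclic_point r n.
Proof.
move=> x0 xZ.
have [Y YE] : exists Y : nat, x 0 ord0 = Y%:R / m%:R.
  have := xZ ord0; rewrite cyclic_mxM eqxx intrEge0 ?mulr_ge0// => /natrP[Y YE].
  by exists Y; rewrite -YE mulfK.
exists (Y %% m)%N.
have rm : (Y %% m < m)%N by rewrite ltn_pmod.
suff /choice[n nP] : forall j, exists n : nat,
    x 0 j = n%:R + (residue (Y %% m) j)%:R / m%:R.
  by exists n; split=> //; apply/rowP => j; rewrite mxE nP.
have YR : Y%:R = (Y %/ m)%:R * m%:R + (Y %% m)%:R :> R.
  by rewrite -natrM -natrD -divn_eq.
move=> j; apply: int_natP; rewrite ?ltn_pmod//.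
have [->|j0] := eqVneq j ord0.
  by rewrite residue0// YE YR mulrDl mulfK// addrK natr_int.
have := xZ j; rewrite cyclic_mxM (negPf j0) YE YR => jZ.
set q := ((a j * (Y %% m)) %/ m)%N.
have -> : (residue (Y %% m) j)%:R = (a j * (Y %% m))%:R - (q * m)%:R :> R.
  by apply/eqP; rewrite eq_sym subr_eq -natrD residue_div.
move: jZ; rewrite !natrM; move: (Y %/ m)%N (Y %% m)%N q => A B q jZ.
have -> : x 0 j - ((a j)%:R * B%:R - q%:R * m%:R) / m%:R =
   (x 0 j - (A%:R * m%:R + B%:R) / m%:R * (a j)%:R) + A%:R * (a j)%:R + q%:R.
  by field.
by rewrite rpredD ?natr_int// rpredD// rpredM ?natr_int.
Qed.

(** The class is recovered from column 0, where m x_0 = m n_0 + r with r < m. *)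
Lemma cyclic_point_inj r n r' n' : (r < m)%N -> (r' < m)%N ->
  cyclic_point r n = cyclic_point r' n' -> r = r' /\ n =1 n'.
Proof.
move=> rm rm' E.
have rr' : r = r'.
  have := congr1 (fun x : 'rV[R]_d.+1 => x 0 ord0 * m%:R) E.
  rewrite !mxE !residue0// !mulrDl !divfK// -!natrM -!natrD => /eqP.
  rewrite eqr_nat => /eqP/(congr1 (modn^~ m)).
  by rewrite !modnMDl !modn_small.
split=> // j; apply/eqP; rewrite -(eqr_nat R); apply/eqP.
have := congr1 (fun x : 'rV[R]_d.+1 => x 0 j) E.
by rewrite !mxE rr' => /addIr.
Qed.

(** * Counting the lattice points of a dilated simplex *)

Lemma card_cyclic_simplex t : (0 < t)%N ->
  (dilate t (convex_hull (simplex_vertices V)) `&` @integer_points R d.+1 #=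
   `I_(\sum_(r < m) if age r <= t then 'C(d.+1 + (t - age r), d.+1) else 0)%N)%card.
Proof.
move=> t0; rewrite dilate_simplex//.
(* In a class r the integer parts are d+1 naturals of sum at most t - age r. Bounding each entry by
   that same number loses nothing and makes the type finite. The test [age r <= t] discards the
   classes where the subtraction would truncate. *)
pose fits (r : 'I_m) (s : d.+1.-tuple 'I_(t - age r).+1) :=
  (age r <= t)%N && (\sum_(i <- s) i <= t - age r)%N.
pose T := {r : 'I_m & {s | fits r s}}.
pose n (z : T) j : nat := tnth (sval (projT2 z)) j.
have nE (z : T) : (\sum_(i <- sval (projT2 z)) i = \sum_j n z j)%N by rewrite big_tuple.
have -> : (\sum_(r < m) if age r <= t then 'C(d.+1 + (t - age r), d.+1) else 0)%N = #|{: T}|.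
  rewrite card_tagged sumnE big_map big_enum/=; apply: eq_bigr => r _.
  rewrite card_sig; case: ifP => rt; last first.
    by apply/esym/eq_card0 => s; rewrite !inE /fits rt.
  rewrite -card_partial_ord_partitions; apply/esym/eq_card => s.
  by rewrite !inE /fits rt.
apply: (@card_eq_ord _ _ _ (fun z : T => cyclic_point (projT1 z) (n z) *m V)).
  move=> z z' /(can_inj (mulmxK cyclic_mx_unit)) E.
  have [] := cyclic_point_inj (ltn_ord _) (ltn_ord _) E.
  case: z z' {E} => [r s] [r' s'] /= /val_inj rr'; case: _ / rr' in s' * => nn.
  congr existT; apply/val_inj/eq_from_tnth => j; exact/val_inj/nn.
apply/seteqP; split=> [_ [z _ <-]|_ [[x [x0 xt] <-] xZ]].
  split; last exact/cyclic_point_int/ltn_ord.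
  exists (cyclic_point (projT1 z) (n z)) => //; split; first exact: cyclic_point_ge0.
  rewrite cyclic_point_le -nE.
  have /andP[? ?] := valP (projT2 z).
  by rewrite addnC -leq_subRL.
have [r [k [rm xE]]] := cyclic_point_surj x0 xZ.
move: xt; rewrite xE cyclic_point_le => kt.
have rt : (age r <= t)%N by apply: leq_trans kt; rewrite leq_addl.
have kt' : (\sum_j k j <= t - age r)%N by rewrite leq_subRL// addnC.
have kj j : (k j < (t - age r).+1)%N.
  by rewrite ltnS (leq_trans _ kt')// (bigD1 j)//= leq_addr.
pose s := [tuple Ordinal (kj j) | j < d.+1].
have fs : fits (Ordinal rm) s.
  rewrite /fits rt big_tuple (eq_bigr k) => [//|j _].
  by rewrite tnth_mktuple.
exists (existT _ (Ordinal rm) (exist _ s fs)) => //=; congr (cyclic_point _ _ *m V).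
by apply/funext => j; rewrite /n /= tnth_mktuple.
Qed.

(** The age is the ceiling of a sum of d+1 fractions below 1. This bound lets the count in each
    class agree with a polynomial at every t >= 1. *)
Lemma age_le r : (age r <= d.+1)%N.
Proof.
rewrite /age -ltnS ltn_divLR//.
have : (\sum_j residue r j <= \sum_(j < d.+1) m.-1)%N.
  by apply: leq_sum => j _; rewrite -ltnS prednK// ltn_pmod.
rewrite sum_nat_const card_ord; nia.
Qed.

(* 'C(t + e - k, e) as a polynomial in t *)
Definition binomial_poly e k : {poly R} :=
  (e`!%:R)^-1 *: \prod_(i < e) ('X + (e%:R - k%:R - i%:R)%:P).

Lemma binomial_polyE e k t : (k <= e)%N -> (0 < t)%N ->
  (binomial_poly e k).[t%:R] = (if (k <= t)%N then 'C(e + (t - k), e) else 0%N)%:R.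
Proof.
move=> ke t0; rewrite hornerZ horner_prod.
under eq_bigr do rewrite !hornerE.
case: ifP => [kt|/negbT]; last first.
  (* For t < k <= e, the factor of index t + e - k of the product vanishes, in agreement with the
     empty count. *)
  rewrite -ltnNge => tk; have ti : (t + e - k < e)%N by lia.
  rewrite (bigD1 (Ordinal ti))//= natrB ?natrD; last by lia.
  by rewrite [X in _ * (X * _)](_ : _ = 0) ?mul0r ?mulr0//; ring.
have eN0 : e`!%:R != 0 :> R by rewrite pnatr_eq0 -lt0n fact_gt0.
apply: (mulfI eN0); rewrite mulVKf// -natrM mulnC bin_ffact ffact_prod natr_prod.
apply: eq_bigr => i _; rewrite natrB; last by have := ltn_ord i; lia.
by rewrite natrD natrB//=; ring.
Qed.

Lemma realizes_cyclic_simplex :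
  realizes d.+1 (\sum_(r < m) binomial_poly d.+1 (age r)).
Proof.
exists (convex_hull (simplex_vertices V)); split.
- exists (simplex_vertices V); split=> //; first exact: finite_simplex_vertices.
  move=> _ [->|[i ->]] j; rewrite !mxE ?rpred0//.
  by case: ifP => _; [case: ifP => _|]; rewrite ?rpredN ?natr_int.
- exact/affine_hull_simplex/cyclic_mx_unit.
- move=> t t0; eexists; first exact: card_cyclic_simplex.
  rewrite horner_sum natr_sum; apply: eq_bigr => r _.
  by rewrite binomial_polyE ?age_le.
Qed.

End Simplices.

(** * The building blocks *)

Section Blocks.
Variable R : realType.

Lemma binomial_poly2 k : 2%:R *: binomial_poly R 2 k =
  ('X + 2%:R - k%:R) * ('X + 1 - k%:R).
Proof.
rewrite /binomial_poly scalerA mulfV ?pnatr_eq0// scale1r !big_ord_recl big_ord0.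
rewrite /= /bump /= !polyCB !polyC_natr mulr1; ring.
Qed.

Lemma binomial_poly3 k : 6%:R *: binomial_poly R 3 k =
  ('X + 3%:R - k%:R) * ('X + 2%:R - k%:R) * ('X + 1 - k%:R).
Proof.
rewrite /binomial_poly scalerA mulfV ?pnatr_eq0// scale1r !big_ord_recl big_ord0.
rewrite /= /bump /= !polyCB !polyC_natr mulr1; ring.
Qed.

(** With m = 1 and d = 0 the simplex is [0, 1], and its only class has age 0. *)
Lemma realizes_segment : realizes 1 ('X + 1 : {poly R}).
Proof.
have := @realizes_cyclic_simplex R 0 1 (fun=> 1%N) isT erefl.
rewrite big_ord1 /age big_ord1 /residue /= modn1 divn1 /binomial_poly big_ord1.
by rewrite invr1 scale1r subr0 subr0.
Qed.

(* The ages of 0, of 1, ..., k and of k + 1, ..., 2k are 0, 1 and 2. *)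
Lemma realizes_triangle k : exists p : {poly R}, realizes 2 p /\
  2%:R *: p = 2%:R + 3%:R * 'X + (2%:R * k%:R + 1) * 'X^2.
Proof.
pose a (_ : 'I_2) := 1%N.
have := @realizes_cyclic_simplex R 1 k.*2.+1 a isT erefl.
set p := \sum_(r < _) _ => pP; exists p; split=> //.
have ageE r : (r < k.*2.+1)%N ->
    age k.*2.+1 a r = ((r * 2 + k.*2) %/ k.*2.+1)%N.
  move=> rk; rewrite /age.
  under eq_bigr do rewrite /residue mul1n modn_small//.
  by rewrite sum_nat_const card_ord mulnC.
have age1 r : (1 <= r < k.+1)%N -> age k.*2.+1 a r = 1%N.
  by move=> rk; rewrite ageE; [apply/eqP; rewrite eqn_leq -ltnS ltn_divLR// leq_divRL//; lia|lia].
have age2 r : (k.+1 <= r < k.*2.+1)%N -> age k.*2.+1 a r = 2%N.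
  by move=> rk; rewrite ageE; [apply/eqP; rewrite eqn_leq -ltnS ltn_divLR// leq_divRL//; lia|lia].
have -> : p = binomial_poly R 2 0 + binomial_poly R 2 1 * k%:R + binomial_poly R 2 2 * k%:R.
  rewrite /p -(big_mkord xpredT (fun r => binomial_poly R 2 (age k.*2.+1 a r))).
  rewrite (@big_cat_nat _ _ _ 1)//= (@big_cat_nat _ _ _ k.+1 1)//=; last by lia.
  rewrite big_nat1 ageE// mul0n add0n divn_small// -addrA; congr (_ + (_ + _)).
    rewrite (eq_big_nat _ _ (F2 := fun=> binomial_poly R 2 1)) => [|r /age1->//].
    by rewrite sumr_const_nat subn1 mulr_natr.
  rewrite (eq_big_nat _ _ (F2 := fun=> binomial_poly R 2 2)) => [|r /age2->//].
  by rewrite sumr_const_nat subSS -addnn addnK mulr_natr.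
rewrite !scalerDr !scalerAl !binomial_poly2; ring.
Qed.

(** Take m = n + 1 and a = (1, 1, n). A class r from 1 to n has residues r, r and n + 1 - r, of sum
    n + 1 + r, hence age 2; the class 0 has age 0. The linear coefficient is negative once n > 11,
    which is the source of the negative signs. *)
Lemma realizes_reeve n : exists p : {poly R}, realizes 3 p /\
  6%:R *: p = 6%:R + (11%:R - n%:R) * 'X + 6%:R * 'X^2 + (n%:R + 1) * 'X^3.
Proof.
pose a (j : 'I_3) := nth 0%N [:: 1; 1; n]%N j.
have := @realizes_cyclic_simplex R 2 n.+1 a isT erefl.
set p := \sum_(r < _) _ => pP; exists p; split=> //.
have age2 (r : 'I_n) : age n.+1 a r.+1 = 2%N.
  have rn := ltn_ord r.
  rewrite /age !big_ord_recl big_ord0 /residue /a /= !mul1n modn_small//.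
  have -> : ((n * r.+1) %% n.+1 = n - r)%N.
    have -> : (n * r.+1 = r * n.+1 + (n - r))%N by nia.
    by rewrite modnMDl modn_small//; lia.
  apply/eqP; rewrite eqn_leq -ltnS ltn_divLR// leq_divRL//; lia.
have -> : p = binomial_poly R 3 0 + binomial_poly R 3 2 * n%:R.
  rewrite /p big_ord_recl; congr (_ + _).
    rewrite /age !big_ord_recl big_ord0 /residue !muln0 mod0n.
    by rewrite divn_small.
  rewrite (eq_bigr (fun=> binomial_poly R 3 2)) => [|r _]; last by rewrite age2.
  by rewrite sumr_const card_ord mulr_natr.
rewrite scalerDr scalerAl !binomial_poly3; ring.
Qed.

(** * Integer coefficient lists, lowest degree first *)

Definition Zcoef (z : Z) : R := (int_of_Z z)%:~R.

Lemma ZcoefD x y : Zcoef (x + y) = Zcoef x + Zcoef y.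
Proof. by rewrite /Zcoef !rmorphD. Qed.

Lemma ZcoefB x y : Zcoef (x - y) = Zcoef x - Zcoef y.
Proof. by rewrite /Zcoef !rmorphB. Qed.

Lemma ZcoefM x y : Zcoef (x * y) = Zcoef x * Zcoef y.
Proof. by rewrite /Zcoef !rmorphM. Qed.

Lemma ZcoefX x n : Zcoef (x ^+ n) = Zcoef x ^+ n.
Proof. by rewrite /Zcoef !rmorphXn. Qed.

Lemma Zcoef_nat n : Zcoef n%:R = n%:R.
Proof. by rewrite /Zcoef !rmorph_nat. Qed.

Lemma Zcoef_pos c : Zcoef (Zpos c) = (Pos.to_nat c)%:R.
Proof. by []. Qed.

Lemma Zcoef_lt0 z : (Zcoef z < 0) = (z < 0).
Proof. by rewrite /Zcoef ltrz0; apply/idP/idP; lia. Qed.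

Lemma Zcoef_gt0 z : (0 < Zcoef z) = (0 < z).
Proof. by rewrite /Zcoef ltr0z; apply/idP/idP; lia. Qed.

Definition Zpoly (s : seq Z) : {poly R} := Poly [seq Zcoef z | z <- s].

(** Polynomial arithmetic is redone on lists of binary integers so that the signs can be obtained by
    evaluation. *)
Fixpoint add_coefs (s t : seq Z) : seq Z :=
  match s, t with
  | [::], _ => t
  | _, [::] => s
  | x :: s', y :: t' => Z.add x y :: add_coefs s' t'
  end.

Fixpoint mul_coefs (s t : seq Z) : seq Z :=
  if s is x :: s' then add_coefs (map (Z.mul x) t) (Z0 :: mul_coefs s' t) else [::].

Lemma Zpoly_cons x s : Zpoly (x :: s) = Zpoly s * 'X + (Zcoef x)%:P.
Proof. by rewrite /Zpoly /= cons_poly_def. Qed.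

Lemma Zpoly_add s t : Zpoly (add_coefs s t) = Zpoly s + Zpoly t.
Proof.
elim: s t => [|x s IHs] [|y t]; rewrite ?[Zpoly [::]]/Zpoly ?add0r ?addr0//.
rewrite [add_coefs _ _]/= !Zpoly_cons IHs -[Z.add x y]/(x + y) ZcoefD polyCD; ring.
Qed.

Lemma Zpoly_scale x s : Zpoly (map (Z.mul x) s) = (Zcoef x)%:P * Zpoly s.
Proof.
elim: s => [|y s IHs]; first by rewrite /Zpoly mulr0.
rewrite map_cons !Zpoly_cons IHs -[Z.mul x y]/(x * y) ZcoefM polyCM; ring.
Qed.

Lemma Zpoly_mul s t : Zpoly (mul_coefs s t) = Zpoly s * Zpoly t.
Proof.
elim: s => [|x s IHs]; first by rewrite /Zpoly mul0r.
rewrite [mul_coefs _ _]/= Zpoly_add Zpoly_scale !Zpoly_cons IHs (Zcoef_nat 0) addr0; ring.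
Qed.

(** The positive factor [c] clears the denominators and leaves all signs of coefficients
    unchanged. *)
Definition represents d s :=
  exists p c, [/\ realizes d p, 0 < c & c *: p = Zpoly s].

Lemma represents_mul m n s t :
  represents m s -> represents n t -> represents (m + n) (mul_coefs s t).
Proof.
move=> [p [b [pP b0 pE]]] [q [c [qP c0 qE]]]; exists (p * q), (b * c); split.
- exact: realizes_mul.
- exact: mulr_gt0.
- by rewrite Zpoly_mul -pE -qE -scalerAl -scalerAr scalerA.
Qed.

End Blocks.

(* [c] is a dilation factor; [k] and [n] are the parameters of the h*-vectors
   1 + k z + k z^2 and 1 + n z^2. *)
Inductive block :=
  | Segment (c : positive)
  | Triangle (k c : positive)
  | Reeve (n c : positive).

Definition block_dim b :=
  match b with Segment _ => 1%N | Triangle _ _ => 2%N | Reeve _ _ => 3%N end.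

(* The coefficients of d! i(P,t) in dimension d. *)
Definition block_coefs b : seq Z :=
  match b with
  | Segment c => [:: 1; Zpos c]
  | Triangle k c => [:: 2%:R; 3%:R * Zpos c; (2%:R * Zpos k + 1) * Zpos c ^+ 2]
  | Reeve n c =>
    [:: 6%:R; (11%:R - Zpos n) * Zpos c; 6%:R * Zpos c ^+ 2; (Zpos n + 1) * Zpos c ^+ 3]
  end.

Lemma represents_block (R : realType) b : represents R (block_dim b) (block_coefs b).
Proof.
have c0 c : (0 < Pos.to_nat c)%N by lia.
have Zpoly0 : Zpoly R [::] = 0 by [].
have compn (q : {poly R}) n : n%:R \Po q = n%:R by rewrite -polyC_natr comp_polyC.
have comp1 (q : {poly R}) : 1 \Po q = 1 := compn q 1%N.
have Zcoef1 : Zcoef R 1 = 1 := Zcoef_nat R 1.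
have compE := (comp_polyB, comp_polyD, comp_polyM, comp_polyX, compn, comp1).
have ZcoefE := (Zcoef1, Zcoef_nat, ZcoefB, ZcoefD, ZcoefM, ZcoefX, Zcoef_pos).
have polyE := (polyCB, polyCD, polyCM, polyC_exp, polyC_natr, polyC1).
case: b => [c|k c|n c].
- exists (('X + 1) \Po ((Pos.to_nat c)%:R *: 'X)), 1; split=> //.
    exact/realizes_dilate/realizes_segment.
  rewrite scale1r !compE /block_coefs !Zpoly_cons Zpoly0 !ZcoefE.
  by rewrite -mul_polyC !polyE; ring.
- have [p [pP pE]] := realizes_triangle R (Pos.to_nat k).
  exists (p \Po ((Pos.to_nat c)%:R *: 'X)), 2%:R; split=> //.
    exact: realizes_dilate.
  rewrite -comp_polyZ pE !expr2 !compE /block_coefs !Zpoly_cons Zpoly0 !ZcoefE.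
  by rewrite -mul_polyC !polyE; ring.
- have [p [pP pE]] := realizes_reeve R (Pos.to_nat n).
  exists (p \Po ((Pos.to_nat c)%:R *: 'X)), 6%:R; split=> //.
    exact: realizes_dilate.
  rewrite -comp_polyZ pE !exprS !expr0 !compE.
  have E : Zcoef R (11%:R - Zpos n) = 11%:R - (Pos.to_nat n)%:R by rewrite ZcoefB Zcoef_nat.
  rewrite /block_coefs !Zpoly_cons Zpoly0 !(E, ZcoefE).
  by rewrite -mul_polyC !polyE; ring.
Qed.

(* A first factor and the remaining ones. *)
Definition product := (block * seq block)%type.
Definition product_dim (l : product) :=
  foldl (fun d b => (d + block_dim b)%N) (block_dim l.1) l.2.
Definition product_coefs (l : product) :=
  foldl (fun s b => mul_coefs s (block_coefs b)) (block_coefs l.1) l.2.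

(** The induction runs over an arbitrary accumulated dimension and coefficient list, because the
    folds multiply new blocks on the right. *)
Lemma represents_product (R : realType) l : represents R (product_dim l) (product_coefs l).
Proof.
case: l => b l; rewrite /product_dim /product_coefs /=.
elim: l (block_dim b) (block_coefs b) (represents_block R b) => //= c l IHl d s rep.
exact/IHl/represents_mul/represents_block.
Qed.

Lemma represents_coef (R : realType) (p : {poly R}) c s j : 0 < c -> c *: p = Zpoly R s ->
  (p`_j < 0) = (s`_j < 0) /\ (0 < p`_j) = (0 < s`_j).
Proof.
move=> c0 pE; rewrite -(Zcoef_lt0 R) -(Zcoef_gt0 R).
have -> : Zcoef R s`_j = c * p`_j.
  rewrite -coefZ pE coef_Poly; have [js|sj] := ltnP j (size s).
    by rewrite (nth_map 0).
  by rewrite !nth_default ?size_map// (Zcoef_nat R 0).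
by rewrite pmulr_rlt0// pmulr_rgt0.
Qed.

(* Found by random search. The rows are in lexicographic order of the negativity
   pattern of (t^1, ..., t^6), that is, in the order of [behead (bitseqs 6)]. *)
Definition witnesses : seq product :=
  [:: (Triangle 1 4, [:: Reeve 1 7; Reeve 21 1]);
      (Triangle 1 2, [:: Reeve 1 6; Reeve 25 1]);
      (Triangle 1 3, [:: Reeve 24 1; Reeve 1 7]);
      (Triangle 1 1, [:: Reeve 24 1; Reeve 1 4]);
      (Triangle 1 4, [:: Reeve 27 1; Reeve 3 3]);
      (Triangle 1 2, [:: Reeve 1 4; Reeve 28 1]);
      (Triangle 1 2, [:: Reeve 1 7; Reeve 33 1]);
      (Triangle 1 2, [:: Reeve 22 1; Reeve 1 1]);
      (Triangle 1 2, [:: Reeve 14 1; Reeve 21 1]);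
      (Segment 1, [:: Triangle 7 1; Triangle 2 2; Reeve 27 1]);
      (Triangle 1 4, [:: Reeve 31 1; Reeve 7 2]);
      (Triangle 1 3, [:: Reeve 1 1; Reeve 25 1]);
      (Triangle 1 3, [:: Reeve 30 1; Reeve 6 2]);
      (Triangle 1 2, [:: Reeve 1 3; Reeve 34 1]);
      (Triangle 1 3, [:: Reeve 34 1; Reeve 1 5]);
      (Segment 1, [:: Segment 1; Reeve 1 1; Reeve 22 1]);
      (Segment 2, [:: Segment 5; Reeve 20 1; Reeve 16 1]);
      (Segment 1, [:: Segment 2; Reeve 27 1; Reeve 6 2]);
      (Segment 2, [:: Segment 2; Reeve 24 1; Reeve 18 1]);
      (Triangle 1 1, [:: Reeve 4 2; Reeve 27 1]);
      (Segment 15, [:: Triangle 6 1; Triangle 12 1; Reeve 34 1]);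
      (Segment 1, [:: Segment 2; Reeve 6 2; Reeve 28 1]);
      (Segment 2, [:: Segment 2; Reeve 6 4; Reeve 40 1]);
      (Segment 1, [:: Segment 1; Reeve 1 1; Reeve 25 1]);
      (Triangle 1 3, [:: Reeve 10 1; Reeve 33 1]);
      (Segment 4, [:: Segment 1; Reeve 5 2; Reeve 28 1]);
      (Triangle 1 3, [:: Reeve 11 2; Reeve 37 1]);
      (Triangle 1 2, [:: Reeve 1 1; Reeve 31 1]);
      (Triangle 1 4, [:: Reeve 47 1; Reeve 8 1]);
      (Triangle 1 1, [:: Reeve 1 4; Reeve 41 1]);
      (Triangle 1 3, [:: Reeve 50 1; Reeve 1 4]);
      (Triangle 1 1, [:: Reeve 18 3; Reeve 1 1]);
      (Triangle 3 1, [:: Reeve 20 1; Reeve 15 1]);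
      (Triangle 1 1, [:: Reeve 20 1; Reeve 19 1]);
      (Triangle 2 1, [:: Reeve 24 1; Reeve 19 1]);
      (Triangle 1 1, [:: Reeve 25 1; Reeve 9 2]);
      (Triangle 3 1, [:: Reeve 28 1; Reeve 10 2]);
      (Triangle 1 1, [:: Reeve 9 2; Reeve 29 1]);
      (Triangle 1 1, [:: Reeve 27 1; Reeve 27 1]);
      (Triangle 3 2, [:: Reeve 1 1; Reeve 26 2]);
      (Triangle 1 2, [:: Reeve 15 1; Reeve 26 1]);
      (Segment 1, [:: Triangle 5 2; Triangle 21 1; Reeve 28 2]);
      (Triangle 1 2, [:: Reeve 23 1; Reeve 20 1]);
      (Triangle 7 1, [:: Reeve 31 1; Reeve 1 1]);
      (Triangle 5 1, [:: Reeve 31 1; Reeve 6 2]);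
      (Triangle 7 2, [:: Reeve 50 1; Reeve 1 2]);
      (Triangle 2 2, [:: Reeve 8 2; Reeve 36 1]);
      (Triangle 1 1, [:: Reeve 21 2; Reeve 1 1]);
      (Triangle 1 2, [:: Reeve 18 1; Reeve 25 2]);
      (Segment 1, [:: Segment 1; Reeve 19 1; Reeve 16 1]);
      (Segment 2, [:: Segment 2; Reeve 15 1; Reeve 32 1]);
      (Triangle 1 1, [:: Reeve 5 4; Reeve 28 2]);
      (Triangle 2 1, [:: Reeve 238 2; Reeve 18 1]);
      (Segment 1, [:: Segment 1; Reeve 32 1; Reeve 7 2]);
      (Triangle 1 1, [:: Reeve 18 1; Reeve 54 1]);
      (Triangle 1 1, [:: Reeve 31 1; Reeve 1 1]);
      (Triangle 1 2, [:: Reeve 11 1; Reeve 30 1]);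
      (Segment 1, [:: Segment 1; Reeve 52 1; Reeve 9 1]);
      (Triangle 1 2, [:: Reeve 28 1; Reeve 16 1]);
      (Triangle 1 2, [:: Reeve 40 1; Reeve 1 1]);
      (Triangle 1 2, [:: Reeve 58 1; Reeve 9 1]);
      (Triangle 1 2, [:: Reeve 1 2; Reeve 58 1]);
      (Triangle 1 2, [:: Reeve 54 1; Reeve 3 3])].

(** * Sign patterns and their verification *)

(** The all-false sequence comes first, so [behead] removes exactly the pattern without negative
    coefficients. *)
Fixpoint bitseqs n : seq bitseq :=
  if n is n'.+1 then
    [seq false :: b | b <- bitseqs n'] ++ [seq true :: b | b <- bitseqs n']
  else [:: [::]].

Lemma mem_bitseqs b : b \in bitseqs (size b).
Proof.
elim: b => //= x b IHb; rewrite mem_cat.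
by apply/orP; case: x; [right|left]; apply/mapP; exists b.
Qed.

(** The bits of [b] belong to t^1, ..., t^6. The added [false] entries make the constant term and
    the coefficients of t^7 and t^8 positive. *)
Definition pattern_signs (b : bitseq) : seq Z :=
  [seq if x then -1 else 1 | x <- false :: b ++ [:: false; false]].

(** One evaluation checks all 63 products. Equality of the sign lists also excludes zero
    coefficients and fixes their number at nine. *)
Lemma witnesses_signs :
  [seq (product_dim l, [seq Z.sgn z | z <- product_coefs l]) | l <- witnesses] =
  [seq (8%N, pattern_signs b) | b <- behead (bitseqs 6)].
Proof. by vm_compute. Qed.

Lemma exists_witness b : size b = 6%N -> true \in b -> exists l,
  product_dim l = 8%N /\ [seq Z.sgn z | z <- product_coefs l] = pattern_signs b.
Proof.
move=> b6 bT.
have bP : b \in behead (bitseqs 6).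
  have := mem_bitseqs b; rewrite b6 [bitseqs 6]/= inE => /predU1P[b0|//].
  by rewrite b0 in bT.
have : (8%N, pattern_signs b) \in [seq (8%N, pattern_signs b) | b <- behead (bitseqs 6)].
  exact: (map_f (fun b => (8%N, pattern_signs b))).
rewrite -witnesses_signs => /(nthP (0%N, [::]))[k]; rewrite size_map => kw.
pose l0 : product := (Segment 1, [::]).
by rewrite (nth_map l0)// => -[dimE sgnE]; exists (nth l0 witnesses k).
Qed.

Theorem theorem6p7 (R : realType) (q : nat) (hq : (1 <= q)%N)
    (i : 'I_q -> nat)
    (hi : forall a : 'I_q, (1 <= i a <= 6)%N)
    (hmono : forall a b : 'I_q, (a < b)%N -> (i a < i b)%N) :
  exists (N : nat) (P : set 'rV[R]_N) (p : {poly R}),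
    [/\ integral_polytope P, has_dim P 8,
        ehrhart_polynomial P p /\ size p = 9%N,
        forall a : 'I_q, p`_(i a) < 0
      & forall j : nat, (j <= 8)%N -> (forall a : 'I_q, j <> i a) -> 0 < p`_j].
Proof.
pose neg j := [exists a, i a == j].
have negF j : ~~ (0 < j < 7)%N -> neg j = false.
  by move=> jN; apply/existsP => -[a /eqP aj]; move: (hi a); lia.
pose b := [seq neg j | j <- iota 1 6].
(* Since q >= 1, the pattern has a negative position and is therefore among the tabulated ones. *)
have bT : true \in b.
  apply/mapP; exists (i (Ordinal hq)); last by apply/esym/existsP; exists (Ordinal hq).
  by rewrite mem_iota; have := hi (Ordinal hq); lia.
have [||l [ldim lsgn]] := @exists_witness b; [by rewrite size_map|exact: bT|].
have [p [c [pP c0 pE]]] := represents_product R l.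
(* The padding of the pattern agrees with [neg] at 0, 7 and 8, because all the indices lie between 1
   and 6. *)
have {}lsgn : [seq Z.sgn z | z <- product_coefs l] = [seq if neg j then -1 else 1 | j <- iota 0 9].
  by rewrite lsgn /pattern_signs /= (negF 0%N) ?(negF 7%N) ?(negF 8%N).
have ls : size (product_coefs l) = 9%N by rewrite -(size_map Z.sgn) lsgn size_map.
have sgnE j : (j <= 8)%N -> Z.sgn (product_coefs l)`_j = if neg j then -1 else 1.
  move=> j8; rewrite -(nth_map 0 0) ?ls// lsgn.
  by rewrite (nth_map 0%N) ?size_iota// nth_iota.
have p_lt0 j : (j <= 8)%N -> neg j -> p`_j < 0.
  move=> /sgnE sE jN; rewrite jN in sE.
  by have [-> _] := represents_coef j c0 pE; lia.
have p_gt0 j : (j <= 8)%N -> ~~ neg j -> 0 < p`_j.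
  move=> /sgnE sE /negPf jN; rewrite jN in sE.
  by have [_ ->] := represents_coef j c0 pE; lia.
move: pP; rewrite ldim => -[P [latP hP pP]].
exists 8%N, P, p; split.
- exact: lattice_hull_integral.
- exact: has_dim_full.
(* The list of nine coefficients bounds the degree by 8, and the positive coefficient of t^8 shows
   that the bound is attained. *)
- split=> //; apply/eqP; rewrite eqn_leq; apply/andP; split.
    rewrite -(size_scale _ (lt0r_neq0 c0)) pE (leq_trans (size_Poly _))//.
    by rewrite size_map ls.
  by rewrite ltnNge; apply/negP => /leq_sizeP/(_ 8%N (leqnn _)) p8;
     have := p_gt0 8%N isT; rewrite negF// p8 ltxx => /(_ isT).
- by move=> a; apply: p_lt0; [have := hi a; lia|apply/existsP; exists a].
- move=> j j8 jN; apply: p_gt0 => //.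
  by apply/existsP => -[a /eqP aj]; apply: (jN a).
Qed.
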